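(* Let $\mathcal H$ be a hypergraph on a finite set $V$ with $\operatorname{rank}(\mathcal H)\le2$, and let $C_1,\dots,C_q$ be the unforced components of $G_{\mathcal H}$. Let $P,N\subseteq V$ be disjoint. There exists a coatom $M$ of $\operatorname{Mod}(\Phi_{\mathcal H})$ satisfying $P\subseteq M$ and $M\cap N=\varnothing$ if and only if some unforced component $C_i$ contains $N$ and is disjoint from $P$. After the component identifiers and forced status have been stored, this condition can be tested in $O(|P|+|N|+1)$ time.
   Context: A hypergraph on a finite set $V$ is a family $\mathcal H\subseteq 2^V$; $\operatorname{rank}(\mathcal H)=\max_{A\in\mathcal H}|A|$ (zero if $\mathcal H$ is empty). The associated definite Horn CNF is $\Phi_{\mathcal H}=\bigwedge_{A\in\mathcal H}\bigwedge_{v\in A}((A\setminus\{v\})\to v)$, with model family $\operatorname{Mod}(\Phi_{\mathcal H})\subseteq2^V$ (models identified with sets of true variables). A coatom is an inclusion-maximal member of $\operatorname{Mod}(\Phi_{\mathcal H})\setminus\{V\}$. For $\operatorname{rank}(\mathcal H)\le2$, $G_{\mathcal H}$ is the graph on $V$ whose edges are the two-element hyperedges of $\mathcal H$; its connected components include isolated vertices. A component is forced if it contains a vertex $v$ with $\{v\}\in\mathcal H$, and unforced otherwise. The stored data are, for each vertex, the identifier of its component and, for each component, whether it is forced; $P$ and $N$ are given as lists for the purpose of the time bound.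
   Formalization: For empty N the time bound is claimed only when the component identifiers are assigned so that the unforced components come first (such an assignment always exists); with arbitrary identifiers the bound fails already for P = N = ∅. *)

(* Defs.v *)
From mathcomp Require Import all_boot.

Set Implicit Arguments.
Unset Strict Implicit.
Unset Printing Implicit Defensive.

(** * Hypergraphs and their definite Horn CNFs *)

Section Hypergraph.
Variables (V : finType) (H : {set {set V}}).

Definition rank : nat := \max_(A in H) #|A|.

(* The pair [(B, v)] stands for the definite Horn clause [B -> v]. *)
Definition hornCNF : {set {set V} * V} :=
  \bigcup_(A in H) [set (A :\ v, v) | v in A].

Definition models : {set {set V}} :=
  [set M : {set V} | [forall c in hornCNF, (c.1 \subset M) ==> (c.2 \in M)]].

Definition coatom (M : {set V}) : bool :=
  maxset (fun A => A \in models :\ [set: V]) M.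

(** * Components of the graph of two-element hyperedges *)

Definition edge : rel V := [rel x y | (x != y) && ([set x; y] \in H)].

Definition component (x : V) : {set V} := [set y | connect edge x y].

Definition components : {set {set V}} := [set component x | x : V].

Definition forced (C : {set V}) : bool := [exists v in C, [set v] \in H].

Definition unforced_components : {set {set V}} :=
  [set C in components | ~~ forced C].

Definition component_condition (P N : {set V}) : bool :=
  [exists C in unforced_components, (N \subset C) && [disjoint C & P]].

End Hypergraph.

(** * Random access machine

    Structured programs over registers, a read-write work memory and read-only
    input arrays of known length.  Cells hold natural numbers, and every
    operator, read, write and branch costs one unit.  Successor is the only
    arithmetic, so in time [t] no value can exceed by more than [t] all the
    values it was computed from: unit cost cannot be exploited to pack data into
    large numbers. *)

Inductive expr : Type :=
| Const of nat
| Reg of nat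
| Len of nat             (* length of an input array *)
| Input of nat & expr    (* cell of an input array *)
| Work of expr           (* cell of the work memory *)
| Succ of expr
| Eq of expr & expr
| Lt of expr & expr.

Inductive cmd : Type :=
| Skip
| Assign of nat & expr
| Write of expr & expr
| Seq of cmd & cmd
| If of expr & cmd & cmd
| While of expr & cmd.

Record state := State { regs : nat -> nat; work : nat -> nat }.

Definition upd (f : nat -> nat) (i v : nat) : nat -> nat :=
  fun j => if j == i then v else f j.

Section Semantics.
Variable inp : seq (seq nat).

Fixpoint eval (s : state) (e : expr) : nat :=
  match e with
  | Const n => n
  | Reg r => regs s r
  | Len a => size (nth [::] inp a)
  | Input a e1 => nth 0 (nth [::] inp a) (eval s e1)
  | Work e1 => work s (eval s e1)
  | Succ e1 => (eval s e1).+1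
  | Eq e1 e2 => eval s e1 == eval s e2
  | Lt e1 e2 => eval s e1 < eval s e2
  end.

Fixpoint ecost (e : expr) : nat :=
  match e with
  | Const _ | Reg _ | Len _ => 1
  | Input _ e1 | Work e1 | Succ e1 => (ecost e1).+1
  | Eq e1 e2 | Lt e1 e2 => (ecost e1 + ecost e2).+1
  end.

(* [exec c s t s'] : from state [s], program [c] halts in state [s'] after
   exactly [t] units of time.  A test succeeds when its value is nonzero. *)
Inductive exec : cmd -> state -> nat -> state -> Prop :=
| ExecSkip s : exec Skip s 1 s
| ExecAssign s r e :
    exec (Assign r e) s (ecost e).+1
         (State (upd (regs s) r (eval s e)) (work s))
| ExecWrite s e1 e2 :
    exec (Write e1 e2) s (ecost e1 + ecost e2).+1
         (State (regs s) (upd (work s) (eval s e1) (eval s e2)))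
| ExecSeq c1 c2 s1 s2 s3 t1 t2 :
    exec c1 s1 t1 s2 -> exec c2 s2 t2 s3 -> exec (Seq c1 c2) s1 (t1 + t2) s3
| ExecIf e c1 c2 s s' t :
    exec (if eval s e != 0 then c1 else c2) s t s' ->
    exec (If e c1 c2) s ((ecost e).+1 + t) s'
| ExecWhileStop e c s :
    eval s e = 0 -> exec (While e c) s (ecost e).+1 s
| ExecWhileStep e c s1 s2 s3 t1 t2 :
    eval s1 e != 0 -> exec c s1 t1 s2 -> exec (While e c) s2 t2 s3 ->
    exec (While e c) s1 ((ecost e).+1 + t1 + t2) s3.

End Semantics.

(** * Stored data *)

Record storage (V : finType) := Storage {
  ncomp : nat;
  comp_id : V -> 'I_ncomp;
  forced_flag : 'I_ncomp -> bool
}.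

Arguments comp_id {V} s _.
Arguments forced_flag {V} s _.

(* The identifiers [0, ..., ncomp - 1] are in bijection with the components. *)
Definition stores (V : finType) (H : {set {set V}}) (D : storage V) : Prop :=
  [/\ forall x y : V,
        (comp_id D x == comp_id D y) = (component H x == component H y),
      forall i : 'I_(ncomp D), exists x : V, comp_id D x = i
    & forall x : V, forced_flag D (comp_id D x) = forced H (component H x)].

(* The unforced components [C_1, ..., C_q] receive the identifiers
   [0, ..., q - 1].  For [N = set0] the test asks for an unforced component
   missing [P]; already for [P = set0] this is the disjunction of all negated
   flags, so under an arbitrary numbering it cannot be found in bounded time. *)
Definition unforced_first (V : finType) (D : storage V) : Prop :=
  forall i j : 'I_(ncomp D),
    ~~ forced_flag D i -> forced_flag D j -> i < j.

(* Vertices are represented by their ranks in [enum V]. *)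
Definition vertex_list (V : finType) (s : seq V) : seq nat :=
  [seq (enum_rank x : nat) | x <- s].

Definition test_input (V : finType) (D : storage V) (ps ns : seq V) :
    seq (seq nat) :=
  [:: [seq (comp_id D x : nat) | x <- enum V];
      [seq (forced_flag D i : nat) | i <- enum 'I_(ncomp D)];
      vertex_list ps;
      vertex_list ns].

(* The register and work contents of [s] are arbitrary, so no cleared scratch
   space is presupposed; the answer is read from register 0. *)
Definition tests_within (V : finType) (H : {set {set V}}) (D : storage V)
    (prog : cmd) (P N : {set V}) (ps ns : seq V) (bound : nat) : Prop :=
  forall s : state, exists (t : nat) (s' : state),
    [/\ exec (test_input D ps ns) prog s t s',
        t <= bound
      & (regs s' 0 != 0) = component_condition H P N].

(* Main.v *)
Require Import Defs.
From mathcomp Require Import all_boot.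
From mathcomp Require Import zify.

Set Implicit Arguments.
Unset Strict Implicit.
Unset Printing Implicit Defensive.

(** In rank two every clause of the CNF is a unit or one half of an equivalence
    between adjacent vertices, so a model is a union of components that contains
    all the forced ones ([modelsP]).  A proper model therefore misses a whole
    unforced component, and since the complement of an unforced component is
    itself a model, these complements are exactly the coatoms ([coatomP]).  The
    inclusions [P \subset ~: C] and [~: C :&: N = set0] then read: [C] misses
    [P] and contains [N].

    For the test there are two cases.  If [N] has a point [x0], the only
    candidate is the component of [x0]: its flag is looked up and the identifiers
    of the other points of [N] and of those of [P] are compared with its own.  If
    [N] is empty, the question is whether some unforced component avoids [P].
    When the unforced components are numbered first, only the identifiers
    [0, ..., #|P|] need be considered: either they exhaust the unforced
    components, or they are [#|P| + 1] unforced components, of which [P] meets at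
    most [#|P|] ([component_condition_empty]).  The corresponding [#|P| + 1]
    memory cells are cleared before use because memory starts with arbitrary
    contents; then the components met by [P] are marked and an unmarked unforced
    one is sought.

    Running times are bounded by a small calculus of total-correctness judgments
    that carry a time budget ([halts]); its one substantial rule is that for
    counting loops ([halts_for]). *)

(** * Components and coatoms *)

Section Coatoms.
Variables (V : finType) (H : {set {set V}}).

Lemma edge_sym : symmetric (edge H).
Proof. by move=> x y; rewrite /edge /= eq_sym setUC. Qed.

Lemma component_refl x : x \in component H x.
Proof. by rewrite inE connect0. Qed.

Lemma eq_component x y :
  (component H x == component H y) = (y \in component H x).
Proof.
apply/eqP/idP=> [->|]; first exact: component_refl.
rewrite inE => xy; apply/setP=> z; rewrite !inE.
exact: (same_connect (sym_connect_sym edge_sym)).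
Qed.

Lemma unforced_component x :
  (component H x \in unforced_components H) = ~~ forced H (component H x).
Proof. by rewrite inE imset_f. Qed.

(** In rank two the clauses are the units [v], for hyperedges [{v}], and the
    equivalences between the ends of the edges, so a model is a set that
    contains all singleton hyperedges and cuts no edge. *)
Lemma modelsP (M : {set V}) : rank H <= 2 ->
  M \in models H <->
  (forall v, [set v] \in H -> v \in M) /\ closed (edge H) (mem M).
Proof.
move=> rankH; split=> [|[unitM closedM]].
  rewrite inE => /forall_inP modM.
  have clauseM A v : A \in H -> v \in A -> A :\ v \subset M -> v \in M.
    move=> HA Av; apply/implyP; apply: (modM (A :\ v, v)).
    by apply/bigcupP; exists A => //; apply/imsetP; exists v.
  split=> [v Hv|].
    by apply: (clauseM _ v Hv); rewrite ?set11 // setDv sub0set.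
  apply: (intro_closed (sym_connect_sym edge_sym)) => x y /andP[neq_xy Hxy] Mx.
  apply: (clauseM _ y Hxy); first by rewrite set22.
  apply/subsetP=> z; rewrite !inE => /andP[/negPf-> /=].
  by rewrite orbF => /eqP->.
rewrite inE; apply/forall_inP=> c /bigcupP[A HA /imsetP[v Av ->{c}]] /=.
apply/implyP=> sub_Av.
have cardA : #|A| <= 2 := leq_trans (leq_bigmax_cond _ HA) rankH.
have [A1|/set0Pn[u Avu]] := eqVneq (A :\ v) set0.
  by apply: unitM; move: HA; rewrite -(setD1K Av) A1 setU0.
have uniq_u : A :\ v = [set u].
  apply/esym/eqP; rewrite eqEcard sub1set Avu cards1.
  by move: cardA; rewrite (cardsD1 v A) Av.
have Mu : u \in M := subsetP sub_Av _ Avu.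
have edge_vu : edge H v u.
  rewrite /edge /= -uniq_u setD1K // HA andbT.
  by move: Avu; rewrite !inE eq_sym => /andP[].
by have /= -> := closedM v u edge_vu.
Qed.

Lemma unforced_compl_model C : rank H <= 2 ->
  C \in unforced_components H -> ~: C \in models H :\ [set: V].
Proof.
move=> rankH; rewrite inE => /andP[/imsetP[x _ ->{C}] unforcedC].
rewrite in_setD1; apply/andP; split.
  apply/eqP=> /setP/(_ x).
  by rewrite in_setC component_refl in_setT.
apply/(modelsP _ rankH); split=> [v Hv|].
  rewrite in_setC; apply: contra unforcedC => Cv.
  by apply/existsP; exists v; rewrite Cv.
apply: (intro_closed (sym_connect_sym edge_sym)) => y z yz.
rewrite !inE; apply: contra => /connect_trans; apply.
by apply: connect1; rewrite edge_sym.
Qed.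

(** A model cuts no edge, hence misses the whole component of any point it
    misses, and that component is unforced because the model contains every
    singleton hyperedge. *)
Lemma model_avoids_unforced M : rank H <= 2 -> M \in models H :\ [set: V] ->
  exists2 C, C \in unforced_components H & M \subset ~: C.
Proof.
move=> rankH; rewrite in_setD1 => /andP[properM /(modelsP _ rankH)[unitM closedM]].
have /subsetPn[x _ Mx] : ~~ ([set: V] \subset M) by rewrite subTset.
have avoid y : y \in component H x -> y \notin M.
  by rewrite inE => /(closed_connect closedM) <-.
exists (component H x).
  rewrite unforced_component; apply/existsP=> -[v /andP[Cv /unitM Mv]].
  by move: (avoid v Cv); rewrite Mv.
by apply/subsetP=> y My; rewrite in_setC; apply: contraL My => /avoid.
Qed.

Lemma coatomP M : rank H <= 2 ->
  coatom H M <-> exists2 C, C \in unforced_components H & M = ~: C.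
Proof.
move=> rankH; split=> [/maxsetP[modM maxM]|[C unfC ->{M}]].
  have [C unfC subMC] := model_avoids_unforced rankH modM.
  by exists C => //; rewrite (maxM (~: C)) //; apply: unforced_compl_model.
apply/maxsetP; split=> [|M modM subCM]; first exact: unforced_compl_model.
have [D unfD subMD] := model_avoids_unforced rankH modM.
(* The two components are nested, hence equal. *)
suff eqCD : C = D by apply/eqP; rewrite eqEsubset subCM eqCD subMD.
have: D \subset C by rewrite -setCS (subset_trans subCM).
move: unfC unfD; rewrite !inE => /andP[/imsetP[x _ ->] _] /andP[/imsetP[y _ ->] _].
move/subsetP/(_ y (component_refl y)) => xy.
by apply/eqP; rewrite eq_component.
Qed.

Lemma coatom_separation (P N : {set V}) : rank H <= 2 ->
  (exists M : {set V}, [/\ coatom H M, P \subset M & M :&: N = set0]) <->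
  component_condition H P N.
Proof.
move=> rankH; split=> [[M [/(coatomP _ rankH)[C unfC ->] subP disjN]]|].
  apply/existsP; exists C; rewrite unfC disjoint_sym disjoints_subset subP andbT.
  by move/eqP: disjN; rewrite setI_eq0 disjoint_sym disjoints_subset setCK.
case/existsP=> C /and3P[unfC subN disjP]; exists (~: C); split.
- by apply/(coatomP _ rankH); exists C.
- by rewrite -disjoints_subset disjoint_sym.
- by apply/eqP; rewrite setI_eq0 disjoints_subset setCS.
Qed.

End Coatoms.

(** * Identifiers of components *)

Section Identifiers.
Variables (V : finType) (H : {set {set V}}).

Lemma unforced_first_storage : exists D : storage V, stores H D /\ unforced_first D.
Proof.
pose u := enum (unforced_components H).
pose s := u ++ enum (components H :\: unforced_components H).
have mem_s C : (C \in s) = (C \in components H).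
  rewrite mem_cat !mem_enum in_setD [in RHS]/components.
  by case: (boolP (C \in unforced_components H)) => //; rewrite inE => /andP[->].
have uniq_s : uniq s.
  rewrite cat_uniq !enum_uniq andbT /=; apply/hasPn=> C.
  by rewrite !mem_enum in_setD => /andP[].
have comp_s x : component H x \in s by rewrite mem_s imset_f.
have idx x : index (component H x) s < size s by rewrite index_mem.
pose D := Storage (fun x => Ordinal (idx x))
  (fun i : 'I_(size s) => forced H (nth set0 s i)).
have flagE i : forced_flag D i = (size u <= i).
  rewrite /= nth_cat; case: ltnP => lt_i_u.
    have := mem_nth set0 lt_i_u.
    by rewrite /u mem_enum inE => /andP[_ /negPf].
  have: i - size u < size (enum (components H :\: unforced_components H)).
    by rewrite ltn_subLR // -size_cat ltn_ord.
  move/(mem_nth set0); rewrite mem_enum in_setD => /andP[+ compC].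
  by rewrite inE compC negbK.
exists D; split; last first.
  by move=> i j; rewrite !flagE -ltnNge; apply: leq_trans.
split=> [x y|i|x].
- rewrite -val_eqE /=; apply/eqP/eqP=> [eq_xy|-> //].
  by rewrite -(nth_index set0 (comp_s x)) eq_xy nth_index.
- have /imsetP[x _ nth_i] : nth set0 s i \in components H.
    by rewrite -mem_s mem_nth.
  by exists x; apply: val_inj; rewrite /= -nth_i index_uniq.
- by rewrite /= nth_index.
Qed.

Variables (D : storage V) (storesD : stores H D).

Lemma mem_component_id x y : (y \in component H x) = (comp_id D y == comp_id D x).
Proof.
by case: storesD => eq_id _ _; rewrite -eq_component -eq_id eq_sym.
Qed.

Variables (P N : {set V}) (ps ns : seq V).
Hypotheses (psP : ps =i P) (nsN : ns =i N).

Lemma component_condition_id :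
  component_condition H P N =
  [exists i, [&& ~~ forced_flag D i, all (fun x => comp_id D x == i) ns
              & all (fun x => comp_id D x != i) ps]].
Proof.
case: (storesD) => _ id_onto flagE.
have condE x :
    (N \subset component H x) && [disjoint component H x & P] =
    all (fun y => comp_id D y == comp_id D x) ns &&
    all (fun y => comp_id D y != comp_id D x) ps.
  congr (_ && _).
    apply/subsetP/allP=> sub y; first by rewrite nsN -mem_component_id => /sub.
    by rewrite mem_component_id -nsN => /sub.
  rewrite disjoint_sym disjoint_subset.
  apply/subsetP/allP=> sub y.
    by rewrite psP => /sub; rewrite inE mem_component_id.
  by rewrite -psP => /sub; rewrite inE mem_component_id.
apply/existsP/existsP=> [[C /andP[]]|[i]].
  rewrite inE => /andP[/imsetP[x _ ->] unfC]; rewrite condE => condC.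
  by exists (comp_id D x); rewrite flagE unfC.
have [x <-] := id_onto i; rewrite flagE -condE => /andP[unfC condC].
by exists (component H x); rewrite unforced_component unfC.
Qed.

(** Only the component of a point of [N] can contain [N]. *)
Lemma component_condition_inhabited x0 : x0 \in ns ->
  component_condition H P N =
  [&& ~~ forced_flag D (comp_id D x0),
      all (fun x => comp_id D x == comp_id D x0) ns
    & all (fun x => comp_id D x != comp_id D x0) ps].
Proof.
move=> ns_x0; rewrite component_condition_id.
apply/existsP/idP=> [[i]|cond]; last by exists (comp_id D x0).
case/and3P=> unf_i all_i av_i.
by have /eqP -> := allP all_i x0 ns_x0; apply/and3P.
Qed.

(** The list [ps] meets at most [size ps] components, so when more than
    [size ps] components are unforced one of the first [size ps + 1] of them
    avoids it: larger identifiers never have to be inspected. *)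
Lemma component_condition_empty : N = set0 -> unforced_first D ->
  component_condition H P N =
  has (fun j => [exists i : 'I_(ncomp D),
         [&& val i == j, ~~ forced_flag D i
           & j \notin [seq val (comp_id D x) | x <- ps]]])
      (iota 0 (size ps).+1).
Proof.
move=> N0 firstD; rewrite component_condition_id.
have ->: ns = [::].
  by case: ns nsN => // x s /(_ x); rewrite N0 mem_head inE.
pose ids := [seq val (comp_id D x) | x <- ps].
have avoidE (i : 'I_(ncomp D)) : all (fun x => comp_id D x != i) ps = (val i \notin ids).
  rewrite -has_pred1 has_map -all_predC; apply: eq_all => x /=.
  by rewrite -val_eqE.
apply/existsP/hasP=> [[i /andP[unf_i]]|[j _ /existsP[i /and3P[/eqP<- unf_i av]]]];
  last by exists i; rewrite /= unf_i avoidE.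
rewrite avoidE => av_i.
have [le_i|lt_i] := leqP i (size ps).
  by exists (val i); [rewrite mem_iota | apply/existsP; exists i; rewrite eqxx unf_i].
have: ~~ all (mem ids) (iota 0 (size ps).+1).
  apply/negP=> /allP/(uniq_leq_size (iota_uniq _ _)).
  by rewrite size_iota size_map ltnn.
case/allPn=> j js av_j; exists j => //.
have lt_j : j < ncomp D.
  by move: js; rewrite mem_iota => /andP[_ /leq_trans]; apply; apply: ltn_trans (ltn_ord i).
apply/existsP; exists (Ordinal lt_j); rewrite eqxx; apply/andP; split=> //.
rewrite av_j andbT; apply/negP=> /(firstD _ _ unf_i) /=.
by move: js; rewrite mem_iota /=; lia.
Qed.

End Identifiers.

(** * Timed execution *)

Section Timed.
Variable inp : seq (seq nat).

(** The budget is only an upper bound, so that a loop body whose running time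
    varies from one iteration to the next still has a single budget. *)
Definition halts (c : cmd) (s : state) (b : nat) (Q : state -> Prop) : Prop :=
  exists t s', [/\ exec inp c s t s', t <= b & Q s'].

Lemma halts_weaken c s b b' (Q Q' : state -> Prop) :
  b <= b' -> (forall s', Q s' -> Q' s') -> halts c s b Q -> halts c s b' Q'.
Proof.
move=> le_b subQ [t [s' [run le_t Qs']]]; exists t, s'; split=> //.
  exact: leq_trans le_b.
exact: subQ.
Qed.

Lemma halts_assign s r e (Q : state -> Prop) :
  Q (State (upd (regs s) r (eval inp s e)) (work s)) ->
  halts (Assign r e) s (ecost e).+1 Q.
Proof. by move=> Qs; do 2!eexists; split; [exact: ExecAssign | |]. Qed.

Lemma halts_write s e1 e2 (Q : state -> Prop) :
  Q (State (regs s) (upd (work s) (eval inp s e1) (eval inp s e2))) ->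
  halts (Write e1 e2) s (ecost e1 + ecost e2).+1 Q.
Proof. by move=> Qs; do 2!eexists; split; [exact: ExecWrite | |]. Qed.

Lemma halts_seq c1 c2 s b1 b2 (Q : state -> Prop) :
  halts c1 s b1 (fun s' => halts c2 s' b2 Q) ->
  halts (Seq c1 c2) s (b1 + b2) Q.
Proof.
move=> [t1 [s1 [run1 le1 [t2 [s2 [run2 le2 Qs]]]]]]; exists (t1 + t2), s2.
by split=> //; [exact: ExecSeq run1 run2 | exact: leq_add].
Qed.

Lemma halts_if e c1 c2 s b (Q : state -> Prop) :
  halts (if eval inp s e != 0 then c1 else c2) s b Q ->
  halts (If e c1 c2) s ((ecost e).+1 + b) Q.
Proof.
move=> [t [s' [run le_t Qs]]]; exists ((ecost e).+1 + t), s'.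
by split=> //; [exact: ExecIf | rewrite leq_add2l].
Qed.

Definition for_lt (r : nat) (e : expr) (body : cmd) : cmd :=
  Seq (Assign r (Const 0))
      (While (Lt (Reg r) e) (Seq body (Assign r (Succ (Reg r))))).

(** One iteration costs [ecost e + 3] for the test, [b] for the body and [3] for
    the increment; the initialization and the last, failing test together fit in
    the budget of one further iteration, whence the factor [n.+1].  The invariant
    must not depend on the counter register, which is reset and incremented
    outside the body. *)
Lemma halts_for r e body n b (Inv : nat -> state -> Prop) s :
  (forall s', eval inp s' e = n) ->
  (forall k s' v, Inv k s' -> Inv k (State (upd (regs s') r v) (work s'))) ->
  (forall k s', k < n -> regs s' r = k -> Inv k s' ->
     halts body s' b (fun s'' => regs s'' r = k /\ Inv k.+1 s'')) ->
  Inv 0 s ->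
  halts (for_lt r e body) s ((ecost e + b + 6) * n.+1) (Inv n).
Proof.
move=> bound stable step Inv0.
have loop d : forall k s', k + d = n -> regs s' r = k -> Inv k s' ->
    halts (While (Lt (Reg r) e) (Seq body (Assign r (Succ (Reg r))))) s'
      ((ecost e + b + 6) * d + ecost e + 3) (Inv n).
  elim: d => [|d IHd] k s' def_n def_k Invk.
    rewrite addn0 in def_n; rewrite -def_n.
    exists (ecost e + 3), s'; split=> //; last by lia.
    have ->: ecost e + 3 = (ecost (Lt (Reg r) e)).+1 by rewrite /=; lia.
    by apply: ExecWhileStop; rewrite /= bound def_k def_n ltnn.
  have lt_kn : k < n by lia.
  have [t1 [s1 [run1 le1 [def_k1 Inv1]]]] := step k s' lt_kn def_k Invk.
  pose s2 := State (upd (regs s1) r k.+1) (work s1).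
  have [||t2 [s3 [run2 le2 Qs]]] := IHd k.+1 s2 _ _ (stable _ _ _ Inv1).
  - by lia.
  - by rewrite /= /upd eqxx.
  do 2!eexists; split; last exact: Qs.
    apply: ExecWhileStep (run2); first by rewrite /= bound def_k lt_kn.
    by apply: ExecSeq run1 _; rewrite /s2 -def_k1; apply: ExecAssign.
  by rewrite /=; lia.
have -> : (ecost e + b + 6) * n.+1 =
   2 + ((ecost e + b + 6) * n + ecost e + 3 + b + 1) by lia.
apply: halts_seq; apply: halts_assign.
have le_b : (ecost e + b + 6) * n + ecost e + 3 <=
            (ecost e + b + 6) * n + ecost e + 3 + b + 1 by lia.
apply: (halts_weaken le_b (fun s' => id)).
by apply: (loop n 0); [ | rewrite /= /upd eqxx | exact: stable].
Qed.

Lemma all_iotaS (p : pred nat) k :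
  all p (iota 0 k.+1) = all p (iota 0 k) && p k.
Proof. by rewrite -addn1 iotaD all_cat /= andbT. Qed.

(** A conjunction accumulated in register 0: on truth values, [bad < acc] is
    [acc] and not [bad]. *)
Definition reject_loop (e bad : expr) : cmd :=
  for_lt 1 e (Assign 0 (Lt bad (Reg 0))).

Lemma halts_reject_loop e bad n (isbad : pred nat) (a : bool) s :
  (forall s', eval inp s' e = n) ->
  (forall s', regs s' 2 = regs s 2 -> work s' = work s -> regs s' 1 < n ->
     eval inp s' bad = isbad (regs s' 1)) ->
  regs s 0 = a ->
  halts (reject_loop e bad) s ((ecost e + ecost bad + 9) * n.+1)
    (fun s' => [/\ regs s' 0 = a && all (predC isbad) (iota 0 n),
                   regs s' 2 = regs s 2 & work s' = work s]).
Proof.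
move=> bound badE def_a.
pose Inv k s' := [/\ regs s' 0 = a && all (predC isbad) (iota 0 k),
                     regs s' 2 = regs s 2 & work s' = work s].
have ->: ecost e + ecost bad + 9 = ecost e + (ecost (Lt bad (Reg 0))).+1 + 6.
  by rewrite /=; lia.
apply: (halts_for (Inv := Inv)) => //; last by split; rewrite ?andbT.
move=> k s' lt_kn def_k [acc eq2 eqw]; apply: halts_assign.
split=> //; split=> //; rewrite all_iotaS /= /upd /= badE ?def_k // acc.
by case: (a); case: (all _ _); case: (isbad k).
Qed.

End Timed.

(** * The test *)

Definition id_of (a : nat) (e : expr) : expr := Input 0 (Input a e).

(** Register 2 keeps the identifier of the only candidate, the component of the
    first entry of [N]. *)
Definition inhabited_test : cmd :=
  Seq (Assign 2 (id_of 3 (Const 0)))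
 (Seq (Assign 0 (Eq (Input 1 (Reg 2)) (Const 0)))
 (Seq (reject_loop (Len 3) (Eq (Eq (id_of 3 (Reg 1)) (Reg 2)) (Const 0)))
      (reject_loop (Len 2) (Eq (id_of 2 (Reg 1)) (Reg 2))))).

(** Only the cells up to the length of the list for [P] are cleared and read, so
    it is harmless that marks may land above them.  The inner comparisons are
    again conjunctions with negations: [flag < (mark < (j < Len 1))] holds when
    [j] is an identifier with neither flag nor mark.  The test [j < Len 1] is
    needed because reading the flags out of bounds yields [0], the flag of an
    unforced component.  The loop rejects on success, so its result is negated at
    the end. *)
Definition empty_test : cmd :=
  Seq (for_lt 1 (Succ (Len 2)) (Write (Reg 1) (Const 0)))
 (Seq (for_lt 1 (Len 2) (Write (id_of 2 (Reg 1)) (Const 1)))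
 (Seq (Assign 0 (Const 1))
 (Seq (reject_loop (Succ (Len 2))
         (Lt (Input 1 (Reg 1)) (Lt (Work (Reg 1)) (Lt (Reg 1) (Len 1)))))
      (Assign 0 (Eq (Reg 0) (Const 0)))))).

Definition separation_test : cmd := If (Len 3) inhabited_test empty_test.

Section Test.
Variables (V : finType) (H : {set {set V}}) (D : storage V).
Hypothesis storesD : stores H D.
Variables (P N : {set V}) (ps ns : seq V).
Hypotheses (psP : ps =i P) (nsN : ns =i N).

Let inp := test_input D ps ns.

Lemma size_vertex_list (s : seq V) : size (vertex_list s) = size s.
Proof. exact: size_map. Qed.

Lemma nth_ids (s : seq V) x0 k : k < size s ->
  nth 0 [seq (comp_id D x : nat) | x <- enum V] (nth 0 (vertex_list s) k) =
  comp_id D (nth x0 s k).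
Proof.
move=> lt_k; rewrite /vertex_list [nth 0 _ k](nth_map x0) // (nth_map x0).
  by rewrite nth_enum_rank.
by rewrite -cardE ltn_ord.
Qed.

Lemma nth_flags (i : 'I_(ncomp D)) :
  nth 0 [seq (forced_flag D i : nat) | i <- enum 'I_(ncomp D)] i = forced_flag D i.
Proof. by rewrite (nth_map i) ?nth_ord_enum // size_enum_ord. Qed.

Lemma all_iota_nth (x0 : V) (p : pred nat) (q : pred V) (s : seq V) :
  (forall k, k < size s -> p k = q (nth x0 s k)) ->
  all p (iota 0 (size s)) = all q s.
Proof.
move=> pq; rewrite -[in RHS](mkseq_nth x0 s) all_map.
by apply: eq_in_all => k; rewrite mem_iota => /pq.
Qed.

Lemma halts_inhabited_test s : 0 < size ns ->
  halts inp inhabited_test s (17 * (size ns).+1 + 15 * (size ps).+1 + 9)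
    (fun s' => (regs s' 0 != 0) = component_condition H P N).
Proof.
case def_ns: ns => [//|x0 ns0] _; rewrite -def_ns.
have ns_x0 : x0 \in ns by rewrite def_ns mem_head.
have -> : 17 * (size ns).+1 + 15 * (size ps).+1 + 9 =
  4 + (5 + (17 * (size ns).+1 + 15 * (size ps).+1)) by lia.
apply: halts_seq; apply: halts_assign.
apply: halts_seq; apply: halts_assign => /=.
have ->: upd (regs s) 2 (nth 0 [seq (comp_id D x : nat) | x <- enum V]
    (nth 0 (vertex_list ns) 0)) = upd (regs s) 2 (comp_id D x0).
  by rewrite (nth_ids x0) def_ns.
rewrite {2}/upd /= nth_flags.
set s1 := State _ _.
have loop1 := @halts_reject_loop inp (Len 3)
  (Eq (Eq (id_of 3 (Reg 1)) (Reg 2)) (Const 0)) (size ns)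
  (fun k => comp_id D (nth x0 ns k) != comp_id D x0)
  (~~ forced_flag D (comp_id D x0)) s1.
apply: halts_seq; apply: halts_weaken (loop1 _ _ _) => {loop1} //.
- move=> s2 [acc2 eq2 _].
  have loop2 := @halts_reject_loop inp (Len 2)
    (Eq (id_of 2 (Reg 1)) (Reg 2)) (size ps)
    (fun k => comp_id D (nth x0 ps k) == comp_id D x0) _ s2 _ _ acc2.
  apply: halts_weaken (loop2 _ _) => {loop2} // [s3 [-> _ _]||].
  + rewrite (component_condition_inhabited storesD psP nsN ns_x0) andbA eqb0 negbK.
    rewrite (all_iota_nth (x0 := x0) (q := fun x => comp_id D x == comp_id D x0)).
      by rewrite (all_iota_nth (x0 := x0) (q := fun x => comp_id D x != comp_id D x0)).
    by move=> k _ /=; rewrite negbK.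
  + by move=> s'; rewrite /= size_vertex_list.
  + by move=> s' eq2' _ lt_k; rewrite /= eq2' eq2 (nth_ids x0).
- by move=> s'; rewrite /= size_vertex_list.
- by move=> s' eq2 _ lt_k; rewrite /= eq2 (nth_ids x0) //= -val_eqE eqb0.
- by rewrite /= /upd /=; case: forced_flag.
Qed.

Lemma halts_empty_test s : size ns = 0 -> unforced_first D ->
  halts inp empty_test s (11 * (size ps).+2 + 12 * (size ps).+1 + 2 +
                          20 * (size ps).+2 + 4)
    (fun s' => (regs s' 0 != 0) = component_condition H P N).
Proof.
move=> /size0nil ns0 firstD; pose m := (size ps).+1.
have N0 : N = set0 by apply/setP=> x; rewrite -nsN ns0 !inE.
have len2 s' : eval inp s' (Len 2) = size ps by rewrite /= size_vertex_list.
have len2S s' : eval inp s' (Succ (Len 2)) = m.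
  by rewrite /= size_vertex_list.
rewrite -!addnA; apply: halts_seq.
pose cleared k s' := forall j, j < k -> work s' j = 0.
apply: halts_weaken (halts_for (Inv := cleared) (b := 3) len2S _ _ _) => //.
  move=> s1 clear1; apply: halts_seq.
  pose ids := [seq val (comp_id D x) | x <- ps].
  pose marked k s' := forall j, j < m -> work s' j = (j \in take k ids).
  apply: halts_weaken (halts_for (Inv := marked) (b := 5) len2 _ _ _) => //.
  - move=> s2 mark2; apply: halts_seq; apply: halts_assign; apply: halts_seq.
    set s3 := State _ _.
    have mark3 j : j < m -> work s3 j = (j \in ids).
      by move/mark2; rewrite take_oversize // size_map.
    pose isgood j := [exists i : 'I_(ncomp D),
      [&& val i == j, ~~ forced_flag D i & j \notin ids]].
    have loop := @halts_reject_loop inp (Succ (Len 2))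
      (Lt (Input 1 (Reg 1)) (Lt (Work (Reg 1)) (Lt (Reg 1) (Len 1)))) m
      isgood true s3 len2S _ erefl.
    apply: halts_weaken (loop _) => {loop} //.
      move=> s4 [acc4 _ _]; apply: halts_assign.
      rewrite (component_condition_empty storesD psP nsN N0 firstD).
      by rewrite /= /upd /= acc4 !eqb0 negbK all_predC negbK.
    move=> s4 _ work4 lt_j.
    rewrite /= work4 mark3 // size_map size_enum_ord; set j := regs s4 1.
    have [lt_jn|le_nj] := ltnP j (ncomp D); last first.
      rewrite !ltn0; apply/esym/eqP; rewrite eqb0; apply/existsP=> -[i].
      by case/andP=> /eqP def_i; move: (ltn_ord i); rewrite ltnNge [val i]def_i le_nj.
    have /= -> := nth_flags (Ordinal lt_jn).
    have -> : isgood j = ~~ forced_flag D (Ordinal lt_jn) && (j \notin ids).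
      apply/existsP/idP=> [[i /andP[/eqP def_i]]|good_j].
        by have -> : Ordinal lt_jn = i by apply: val_inj.
      by exists (Ordinal lt_jn); rewrite eqxx.
    by case: forced_flag (j \in ids) => [] [].
  - move=> k s2 lt_k def_k mark2; apply: halts_write; split=> // j lt_j.
    have [x0 _] : exists x0 : V, true by case: (ps) lt_k => // x0; exists x0.
    rewrite /= /upd def_k (nth_ids x0) // (take_nth 0) ?size_map //.
    rewrite mem_rcons inE (nth_map x0) //.
    by case: eqP => //= _; exact: mark2.
  - by move=> j lt_j; rewrite take0 clear1.
- by move=> k s1 lt_k def_k clear1; apply: halts_write; split=> // j;
    rewrite /= /upd def_k ltnS leq_eqVlt; case: eqP => //= _ /clear1.
Qed.

Lemma separation_test_within :
  (N = set0 -> unforced_first D) -> uniq ps -> uniq ns ->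
  tests_within H D separation_test P N ps ns (100 * (#|P| + #|N| + 1)).
Proof.
move=> firstD uniq_ps uniq_ns s.
have <- : size ps = #|P| by rewrite -(eq_card psP) (card_uniqP _).
have <- : size ns = #|N| by rewrite -(eq_card nsN) (card_uniqP _).
have [ns0|ns_gt0] := posnP (size ns).
  apply: (halts_weaken _ (fun s' => id) (halts_if (b := _) _)); last first.
    rewrite /= size_vertex_list ns0 /=; apply: halts_empty_test => //.
    by apply: firstD; apply/setP=> x; rewrite -nsN (size0nil ns0) !inE.
  by rewrite /=; lia.
apply: (halts_weaken _ (fun s' => id) (halts_if (b := _) _)); last first.
  by rewrite /= size_vertex_list -lt0n ns_gt0; apply: halts_inhabited_test.
by rewrite /=; lia.
Qed.

End Test.

Theorem corollary5p2 :
  (forall (V : finType) (H : {set {set V}}) (P N : {set V}),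
     rank H <= 2 -> [disjoint P & N] ->
     (exists M : {set V},
        [/\ coatom H M, P \subset M & M :&: N = set0]) <->
     component_condition H P N)
  /\
  (exists (prog : cmd) (c : nat),
     forall (V : finType) (H : {set {set V}}),
       rank H <= 2 ->
       (exists D : storage V, stores H D /\ unforced_first D) /\
       (forall (D : storage V) (P N : {set V}) (ps ns : seq V),
          stores H D ->
          (N = set0 -> unforced_first D) ->
          [disjoint P & N] ->
          uniq ps -> ps =i P ->
          uniq ns -> ns =i N ->
          tests_within H D prog P N ps ns (c * (#|P| + #|N| + 1)))).
Proof.
split=> [V H P N rankH _|]; first exact: coatom_separation.
exists separation_test, 100 => V H _; split; first exact: unforced_first_storage.
move=> D P N ps ns storesD firstD _ uniq_ps psP uniq_ns nsN.
exact: separation_test_within.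
Qed.
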